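(* Let $N\in\mathbb{N}$ and let $T_0=\sum_{j=1}^N x_j$ be the generating operator of the free group factor $(L(F_N),\tau)$, where $\{x_1,\dots,x_N\}$ is a semicircular system with $L(F_N)=vN(\{x_1,\dots,x_N\})$. Then the moment series and R-transform of $T_0$ are $$M_{T_0}(z)=\sum_{n\ge2,\ n\ \mathrm{even}}\left(c_{n/2}\cdot N^{n/2}\right)z^n,\qquad R_{T_0}(z)=N\cdot z^2$$ in $\mathbb{C}[[z]]$, where $c_k=\frac1{k+1}\binom{2k}{k}$ is the $k$-th Catalan number.
   Context: $F_N$ is the free group on $N$ generators, $L(F_N)$ its group von Neumann algebra, and $\tau$ its canonical trace, $\tau(\sum_{g}\alpha_g g)=\alpha_e$. A semicircular system is a set of mutually free semicircular elements with covariance $1$ (that is, second free cumulant $1$ and all other free cumulants $0$). By Voiculescu there is a semicircular system $\{x_1,\dots,x_N\}$ in $(L(F_N),\tau)$ with $L(F_N)=vN(\{x_1,\dots,x_N\})$, where $vN(S)$ denotes the von Neumann algebra generated by $S$. For a $W^*$-probability space $(A,\varphi)$ and $a\in A$, the moment series is $M_a(z)=\sum_{n\ge1}\varphi(a^n)z^n$ and the R-transform is $R_a(z)=\sum_{n\ge1}k_n^\varphi(a,\dots,a)z^n$, where $k_n^\varphi$ are the free cumulants with respect to $\varphi$. *)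

(* Defs.v *)
From HB Require Import structures.
From mathcomp Require Import all_boot all_order all_algebra finmap.
From mathcomp Require Import complex.
From mathcomp Require Import all_classical all_reals ereal esum.
From mathcomp Require Import topology normedtype.
From mathcomp Require summability.
From mathcomp Require Import ring.

Set Implicit Arguments.
Unset Strict Implicit.
Unset Printing Implicit Defensive.

Import Order.TTheory GRing.Theory Num.Theory.
Import numFieldNormedType.Exports.

Local Open Scope classical_set_scope.
Local Open Scope ring_scope.
Local Open Scope complex_scope.

(* Free group on a set [X] of generators. A letter [(x, false)] stands for [x] *)
(* and [(x, true)] for [x^-1]; the elements are the reduced words and the      *)
(* product is concatenation followed by cancellation.                          *)
Section FreeGroup.
Variable X : choiceType.
Implicit Types (a b : X * bool) (u v w : seq (X * bool)).

Definition letter_inv a := (a.1, ~~ a.2).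

Definition reduced w := sorted (fun a b => b != letter_inv a) w.

Definition push a w :=
  if w is b :: w' then if b == letter_inv a then w' else a :: w else [:: a].

Definition word_mul u v := foldr push v u.

Definition word_inv w := rev (map letter_inv w).

Lemma letter_invK : involutive letter_inv.
Proof. by case=> x b; rewrite /letter_inv /= negbK. Qed.

Lemma reduced_push a w : reduced w -> reduced (push a w).
Proof.
case: w => //= b w; case: ifP => [_|/negbT nab] /=; last by rewrite nab.
by move/path_sorted.
Qed.

Lemma pushK a w : reduced w -> push (letter_inv a) (push a w) = w.
Proof.
case: w => [|b w] /=; first by rewrite letter_invK eqxx.
case: ifP => [/eqP->|_] /=; last by rewrite letter_invK eqxx.
by case: w => [|c w] //= /andP[/negbTE->].
Qed.

Lemma reduced_mul u v : reduced v -> reduced (word_mul u v).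
Proof. by move=> rv; elim: u => //= a u /reduced_push. Qed.

Lemma word_mul1 u : reduced u -> word_mul u [::] = u.
Proof.
elim: u => //= a u IHu ru; rewrite IHu; last exact: path_sorted ru.
by case: u ru {IHu} => //= b u /andP[/negbTE->].
Qed.

Lemma push_mul a u v : reduced v ->
  word_mul (push a u) v = push a (word_mul u v).
Proof.
move=> rv; case: u => //= b u; case: ifP => // /eqP->.
by rewrite -{1}[a]letter_invK pushK ?reduced_mul.
Qed.

Lemma word_mulA u v w : reduced w ->
  word_mul u (word_mul v w) = word_mul (word_mul u v) w.
Proof. by move=> rw; elim: u => //= a u ->; rewrite push_mul. Qed.

Lemma word_invK : involutive word_inv.
Proof.
move=> w; rewrite /word_inv map_rev revK -map_comp -[RHS]map_id.
by apply: eq_map => a /=; rewrite letter_invK.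
Qed.

Lemma reduced_inv w : reduced w -> reduced (word_inv w).
Proof.
rewrite /reduced /word_inv rev_sorted sorted_map; apply: sub_sorted => a b /=.
by apply: contra_neq => ->; rewrite letter_invK.
Qed.

Lemma word_mulV w : word_mul (word_inv w) w = [::].
Proof.
elim: w => // a w IHw; rewrite /word_inv /= rev_cons /word_mul foldr_rcons.
by rewrite /= letter_invK eqxx.
Qed.

Record free_group := FreeGroup {
  free_group_word :> seq (X * bool);
  free_group_reduced : reduced free_group_word }.

HB.instance Definition _ := [isSub for free_group_word].
HB.instance Definition _ := [Choice of free_group by <:].

Definition free_group_one := @FreeGroup [::] isT.
Definition free_group_inv (g : free_group) :=
  FreeGroup (reduced_inv (free_group_reduced g)).
Definition free_group_mul (g h : free_group) :=
  FreeGroup (reduced_mul g (free_group_reduced h)).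

Fact free_group_mulA : associative free_group_mul.
Proof.
by move=> [u ru] [v rv] [w rw]; apply: val_inj; rewrite /= word_mulA.
Qed.

Fact free_group_mul1g : left_id free_group_one free_group_mul.
Proof. by move=> [u ru]; apply: val_inj. Qed.

Fact free_group_mulg1 : right_id free_group_one free_group_mul.
Proof. by move=> [u ru]; apply: val_inj; rewrite /= word_mul1. Qed.

Fact free_group_mulVg :
  left_inverse free_group_one free_group_inv free_group_mul.
Proof. by move=> [u ru]; apply: val_inj; rewrite /= word_mulV. Qed.

Fact free_group_mulgV :
  right_inverse free_group_one free_group_inv free_group_mul.
Proof.
by move=> [u ru]; apply: val_inj; rewrite /= -{1}[u]word_invK word_mulV.
Qed.

HB.instance Definition _ := isGroup.Build free_group
  free_group_mulA free_group_mul1g free_group_mulg1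
  free_group_mulVg free_group_mulgV.

End FreeGroup.

(* The Hilbert space l^2(G) of square-summable complex functions on [G]. *)
Section L2.
Variables (R : realType) (G : choiceType).
Implicit Types f g : G -> R[i]^o.

Definition sqnorm f : \bar R := \esum_(x in setT) (Normc.normc (f x) ^+ 2)%:E.

Lemma sqnorm_ge0 f : (0 <= sqnorm f)%E.
Proof. by apply: esum_ge0 => x _; rewrite lee_fin sqr_ge0. Qed.

Lemma esumZ_le (c : R) (a : G -> \bar R) : 0 <= c -> (forall x, 0 <= a x)%E ->
  (\esum_(x in setT) (c%:E * a x) <= c%:E * \esum_(x in setT) a x)%E.
Proof.
move=> c0 a0; apply: ge_ereal_sup => _ [F finF <-].
rewrite -ge0_mule_fsumr //; apply: lee_pmul => //.
  exact: fsume_ge0.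
by apply: esum_ge; exists F.
Qed.

Lemma sqnorm0 : sqnorm 0 = 0%E.
Proof.
by apply: esum1 => x _; rewrite [X in Normc.normc X]/= Normc.normc0 expr0n.
Qed.

Lemma sqnormZ_le (c : R[i]) f :
  (sqnorm (c *: f)%R <= (Normc.normc c ^+ 2)%:E * sqnorm f)%E.
Proof.
apply: le_trans (esumZ_le _ _); rewrite ?sqr_ge0 //; last first.
  by move=> x; rewrite lee_fin sqr_ge0.
by apply: le_esum => x _; rewrite -EFinM -exprMn -Normc.normcM.
Qed.

Lemma sqnormD_le f g :
  (sqnorm (f + g)%R <= 2%:E * sqnorm f + 2%:E * sqnorm g)%E.
Proof.
have pos h x : (0 <= (Normc.normc (h x) ^+ 2)%:E :> \bar R)%E.
  by rewrite lee_fin sqr_ge0.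
apply: (@le_trans _ _ (\esum_(x in [set: G])
   (2%:E * (Normc.normc (f x) ^+ 2)%:E + 2%:E * (Normc.normc (g x) ^+ 2)%:E))%E).
  apply: le_esum => x _; rewrite -!EFinM -EFinD lee_fin.
  have n0 (z : R[i]) : 0 <= Normc.normc z by case: z => a b; exact: sqrtr_ge0.
  have := le_normcD (f x) (g x).
  have -> : Normc.normc ((f + g) x) = Normc.normc (f x + g x) by [].
  move: (n0 (f x)) (n0 (g x)) (n0 (f x + g x)).
  set p := Normc.normc (f x); set q := Normc.normc (g x).
  set r := Normc.normc (f x + g x) => p0 q0 r0 rpq.
  have : r ^+ 2 <= (p + q) ^+ 2 by rewrite ler_sqr ?nnegrE ?addr_ge0.
  move/le_trans; apply; rewrite -subr_ge0.
  suff -> : 2%:R * p ^+ 2 + 2%:R * q ^+ 2 - (p + q) ^+ 2 = (p - q) ^+ 2.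
    exact: sqr_ge0.
  by ring.
rewrite esumD => [|x _|x _]; try by rewrite mule_ge0.
by apply: leeD; apply: esumZ_le.
Qed.

Definition square_summable : {pred G -> R[i]^o} :=
  [pred f | (sqnorm f < +oo)%E].

Fact square_summable_closed : subsemimod_closed square_summable.
Proof.
split; first split.
- by rewrite inE sqnorm0 ltry.
- move=> f g; rewrite !inE => fN gN; apply: le_lt_trans (sqnormD_le _ _) _.
  by rewrite lte_add_pinfty // lte_mul_pinfty ?sqnorm_ge0.
- move=> c f; rewrite !inE => fN; apply: le_lt_trans (sqnormZ_le _ _) _.
  by rewrite lte_mul_pinfty ?lee_fin ?sqr_ge0.
Qed.

Record l2 := L2 { l2_fun :> G -> R[i]^o; l2P : l2_fun \in square_summable }.

HB.instance Definition _ := [isSub for l2_fun].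
HB.instance Definition _ := [Choice of l2 by <:].
HB.instance Definition _ :=
  GRing.SubChoice_isSubLmodule.Build R[i] (G -> R[i]^o) square_summable l2
    square_summable_closed.

Definition l2dot (f g : l2) : R[i]^o :=
  summability.sum (fun x => f x * (g x)^* : R[i]^o).

Definition delta_fun (x : G) : G -> R[i]^o := fun y => (y == x)%:R.

Fact delta_square_summable x : delta_fun x \in square_summable.
Proof.
suff : (sqnorm (delta_fun x) < +oo)%E by rewrite inE.
have -> : sqnorm (delta_fun x) = \esum_(y in [set x]) (1 : \bar R)%E.
  rewrite esum_mkcond; apply: eq_esum => y _; rewrite /delta_fun.
  have -> : (y \in [set x]%classic) = (y == x) by apply/idP/eqP; rewrite inE.
  by case: eqP => _; rewrite ?Normc.normc1 ?Normc.normc0 ?expr1n ?expr0n.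
by rewrite esum_set1 // ltry.
Qed.

Definition delta (x : G) : l2 := L2 (delta_square_summable x).

End L2.

(* The algebra B(l^2(G)) of bounded operators, with composition as product. *)
Section BoundedOperators.
Variables (R : realType) (G : groupType).
Notation l2 := (l2 R G).
Implicit Types (S T : l2 -> l2) (f g : l2).

Definition bounded_linear : {pred l2 -> l2} := [pred T : l2 -> l2 | `[<
  linear T /\
  exists M : R, forall f, (sqnorm (T f) <= (M ^+ 2)%:E * sqnorm f)%E >] ].

Fact bounded_linear_closed : subsemimod_closed bounded_linear.
Proof.
have sq0 (M : R) : (0 <= (M ^+ 2)%:E)%E by rewrite lee_fin sqr_ge0.
split; first split.
- rewrite inE; split=> [c f g|]; first by rewrite scaler0 addr0.
  by exists 0 => f; rewrite sqnorm0 mule_ge0 ?sqnorm_ge0.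
- move=> S T; rewrite !inE => -[linS [M SM]] [linT [L TL]]; split.
    move=> c f g; rewrite -![(S + T) _]/(S _ + T _) linS linT scalerDr.
    by rewrite addrACA.
  exists (Num.sqrt (2 * M ^+ 2 + 2 * L ^+ 2)) => f.
  have ge0 (K : R) : 0 <= 2 * K ^+ 2 by rewrite mulr_ge0 ?sqr_ge0.
  rewrite sqr_sqrtr; last exact: addr_ge0.
  apply: le_trans (sqnormD_le _ _) _.
  rewrite [X in (_ <= X * _)%E]EFinD ge0_muleDl ?lee_fin //.
  rewrite 2!(EFinM 2) -2!muleA.
  apply: leeD; apply: lee_pmul; rewrite ?lee_fin ?ler0n ?sqnorm_ge0 //.
    exact: SM.
  exact: TL.
- move=> c T; rewrite !inE => -[linT [M TM]]; split.
    move=> d f g; rewrite -![(c *: T) _]/(c *: T _) linT scalerDr !scalerA.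
    by rewrite mulrC.
  exists (Normc.normc c * M) => f; apply: le_trans (sqnormZ_le _ _) _.
  rewrite exprMn (EFinM (_ ^+ 2)) -muleA.
  apply: lee_pmul; rewrite ?sqnorm_ge0 ?sq0 //; exact: TM.
Qed.

Record bop := Bop { bop_fun :> l2 -> l2; bopP : bop_fun \in bounded_linear }.

HB.instance Definition _ := [isSub for bop_fun].
HB.instance Definition _ := [Choice of bop by <:].
HB.instance Definition _ :=
  GRing.SubChoice_isSubLmodule.Build R[i] (l2 -> l2) bounded_linear bop
    bounded_linear_closed.

Lemma bop_linear (T : bop) : linear T.
Proof. by case: T => T /=; rewrite inE => -[]. Qed.

Fact bop_one_subproof : idfun \in bounded_linear.
Proof.
by rewrite inE; split=> //; exists 1 => f; rewrite expr1n mul1e.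
Qed.
Definition bop_one := Bop bop_one_subproof.

Fact bop_mul_subproof (S T : bop) : S \o T \in bounded_linear.
Proof.
case: S T => S /= + [T /= +]; rewrite !inE => -[linS [M SM]] [linT [L TL]].
split=> [c f g|]; first by rewrite /= linT linS.
exists (M * L) => f /=; apply: le_trans (SM _) _.
rewrite exprMn (EFinM (_ ^+ 2)) -muleA.
by apply: lee_pmul; rewrite ?sqnorm_ge0 ?lee_fin ?sqr_ge0.
Qed.
Definition bop_mul (S T : bop) := Bop (bop_mul_subproof S T).

Lemma bop_ext (S T : bop) : S =1 T -> S = T.
Proof. by move=> ST; apply: val_inj; apply/funext. Qed.

Fact bop_mulA : associative bop_mul.
Proof. by move=> S T U; apply: bop_ext. Qed.
Fact bop_mul1 : left_id bop_one bop_mul.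
Proof. by move=> S; apply: bop_ext. Qed.
Fact bop_mulr1 : right_id bop_one bop_mul.
Proof. by move=> S; apply: bop_ext. Qed.
Fact bop_mulDl : left_distributive bop_mul +%R.
Proof. by move=> S T U; apply: bop_ext. Qed.
Fact bop_mulDr : right_distributive bop_mul +%R.
Proof.
move=> S T U; apply: bop_ext => f /=.
by have := bop_linear S 1 (T f) (U f); rewrite !scale1r.
Qed.
Fact bop_one_neq0 : bop_one != 0.
Proof.
apply/eqP => /(congr1 (fun T : bop => l2_fun (T (delta R (1%g : G))) 1%g)) /eqP.
by rewrite /= /delta_fun eqxx oner_eq0.
Qed.

HB.instance Definition _ := GRing.Zmodule_isNzRing.Build bop
  bop_mulA bop_mul1 bop_mulr1 bop_mulDl bop_mulDr bop_one_neq0.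

Fact bop_scalerAl (c : R[i]) (S T : bop) : c *: (S * T) = (c *: S) * T.
Proof. exact: bop_ext. Qed.
HB.instance Definition _ := GRing.Lmodule_isLalgebra.Build R[i] bop bop_scalerAl.

Fact bop_scalerAr (c : R[i]) (S T : bop) : c *: (S * T) = S * (c *: T).
Proof.
apply: bop_ext => f /=; have := bop_linear S c (T f) 0; rewrite !addr0.
have := bop_linear S (-1) 0 0; rewrite scaler0 addr0 scaleN1r addNr => ->.
by rewrite addr0.
Qed.
HB.instance Definition _ := GRing.Lalgebra_isAlgebra.Build R[i] bop bop_scalerAr.

(* A relation, but every bounded [S] has exactly one adjoint [T] (Riesz). *)
Definition is_adjoint (S T : bop) : Prop :=
  forall f g, l2dot (S f) g = l2dot f (T g).

Definition star_closed (M : set bop) : Prop :=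
  forall S T : bop, M S -> is_adjoint S T -> M T.

Definition commutant (M : set bop) : set bop :=
  [set S | forall T : bop, M T -> S * T = T * S].

(* A von Neumann algebra on l^2(G). Being a commutant, [M] is automatically a *)
(* unital subalgebra. *)
Definition von_neumann (M : set bop) : Prop :=
  star_closed M /\ commutant (commutant M) = M.

Definition vN (A : set bop) : set bop :=
  [set T | forall M, von_neumann M -> A `<=` M -> M T].

(* The unital *-algebra generated by [A]. *)
Definition star_alg (A : set bop) : set bop :=
  [set T | forall M : set bop,
     subalg_closed (mem M) -> star_closed M -> A `<=` M -> M T].

Lemma sqnorm_translate (g : G) (f : G -> R[i]^o) :
  sqnorm (fun x => f (g^-1 * x)%g) = sqnorm f.
Proof.
rewrite /sqnorm [RHS](reindex_esum setT setT (fun x => (g^-1 * x)%g)) //.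
split=> // [x y _ _ /mulgI//|x _]; exists (g * x)%g => //.
exact: mulKg.
Qed.

Fact translate_subproof (g : G) (f : l2) :
  (fun x => f (g^-1 * x)%g) \in @square_summable R G.
Proof. by rewrite inE sqnorm_translate; have := l2P f; rewrite inE. Qed.
Definition translate (g : G) (f : l2) : l2 := L2 (translate_subproof g f).

Fact regular_subproof (g : G) : translate g \in bounded_linear.
Proof.
rewrite inE; split=> [c f h|]; first exact: val_inj.
by exists 1 => f; rewrite expr1n mul1e sqnorm_translate.
Qed.
Definition regular (g : G) : bop := Bop (regular_subproof g).

(* L(G), generated by the left regular representation. *)
Definition group_vN : set bop := vN (range regular).

(* If T = \sum_g alpha_g lambda_g, then T delta_e = \sum_g alpha_g delta_g, *)
(* so this is alpha_e. The formula also makes sense outside L(G); moments and *)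
(* cumulants of elements of L(G) only involve values on L(G). *)
Definition group_trace (T : bop) : R[i] := T (delta R 1%g) 1%g.

End BoundedOperators.

(* Formal power series over [K] are given by their coefficients; *)
(* [\fps_(n | P n) E n] is the series of the E(n) z^n with P(n). *)
Notation "\fps_ ( n | P ) E" := (fun n : nat => if P then E else 0)
  (at level 36, E at level 36, n name, format "\fps_ ( n  |  P )  E")
  : ring_scope.

Local Close Scope classical_set_scope.
Local Open Scope set_scope.

Section NoncrossingPartitions.
Variable n : nat.

Definition noncrossing (P : {set {set 'I_n}}) : bool :=
  [forall U in P, forall V in P,
    forall i in U, forall j in V, forall k in U, forall l in V,
      [&& i < j, j < k & k < l]%N ==> (U == V)].

Definition NC (P : {set {set 'I_n}}) : bool :=
  finset.partition P [set: 'I_n] && noncrossing P.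

End NoncrossingPartitions.

(* The entries of [s] at the positions in [V], in increasing order. *)
Definition restr (T : Type) (s : seq T) (V : {set 'I_(size s)}) : seq T :=
  [seq tnth (in_tuple s) i | i <- enum V].

Section FreeProbability.
Variables (K : fieldType) (A : algType K) (phi : A -> K).

(* The free cumulants k_n(a_1, ..., a_n), n >= 1, are determined by the *)
(* moment-cumulant formula (lemma [moment_cumulant] below), solved for the *)
(* term of the one-block partition. The blocks of the other partitions are *)
(* shorter than [s], so [size s] recursive calls suffice. *)
Fixpoint free_cumulant_rec (m : nat) (s : seq A) : K :=
  if m is m'.+1 then
    phi (\prod_(a <- s) a) -
    \sum_(P : {set {set 'I_(size s)}} | NC P && (P != [set [set: 'I__]]))
      \prod_(V in P) free_cumulant_rec m' (restr V)
  else 0.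

Definition free_cumulant (s : seq A) : K := free_cumulant_rec (size s) s.

Lemma size_restr (s : seq A) (V : {set 'I_(size s)}) : size (restr V) = #|V|.
Proof. by rewrite size_map -cardE. Qed.

Lemma restr_setT (s : seq A) : restr [set: 'I_(size s)] = s.
Proof.
rewrite /restr enum_setT -enumT -[RHS]/(tval (in_tuple s)).
by rewrite -[in RHS](map_tnth_enum (in_tuple s)).
Qed.

Lemma proper_block (n : nat) (P : {set {set 'I_n}}) V :
  NC P -> P != [set [set: 'I_n]] -> V \in P -> (0 < #|V| < n)%N.
Proof.
case/andP=> /and3P[/eqP covP trivP P0] _ PT VP.
have V0 : V != finset.set0 by apply: contraNneq P0 => <-.
have Vn : (#|V| <= n)%N by rewrite -[leqRHS]card_ord max_card.
rewrite card_gt0 V0 /= ltn_neqAle Vn andbT.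
apply: contra PT => /eqP cV.
have VT : V = [set: 'I_n].
  by apply/eqP; rewrite eqEcard finset.subsetT cardsT card_ord cV leqnn.
apply/eqP/setP => U; rewrite inE; apply/idP/eqP => [UP|->]; last by rewrite -VT.
apply/eqP; apply: contraT => nU.
have := finset.trivIsetP trivP U V UP VP; rewrite VT => /(_ nU).
rewrite -finset.setI_eq0 finset.setIT => /eqP U0.
by rewrite -U0 UP in P0.
Qed.

Lemma free_cumulant_recE m (s : seq A) : s != [::] -> (size s <= m)%N ->
  free_cumulant_rec m s = free_cumulant s.
Proof.
elim/ltn_ind: m s => m IHm s s0 sm.
rewrite /free_cumulant; case: m sm IHm => [|m] sm IHm.
  by case: s s0 sm.
case sz : (size s) => [|p]; first by move/size0nil: sz s0 => ->.
rewrite /=; congr (_ - _); apply: eq_bigr => P /andP[ncP nP].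
apply: eq_bigr => V VP; have /andP[V0 Vs] := proper_block ncP nP VP.
have r0 : restr V != [::] by rewrite -size_eq0 size_restr -lt0n.
have Vp : (size (restr V) <= p)%N by rewrite size_restr -ltnS -sz.
have Vm : (size (restr V) <= m)%N.
  by rewrite size_restr -ltnS (leq_trans Vs).
by rewrite (IHm m) // (IHm p) // ltnS -ltnS -sz.
Qed.

Lemma moment_cumulant (s : seq A) : s != [::] ->
  phi (\prod_(a <- s) a) =
  \sum_(P : {set {set 'I_(size s)}} | NC P)
    \prod_(V in P) free_cumulant (restr V).
Proof.
move=> s0; have [p sz] : exists p, size s = p.+1.
  by case: s s0 => // a s _; exists (size s).
have ncT : NC [set [set: 'I_(size s)]].
  apply/andP; split.
    rewrite /finset.partition /finset.cover big_set1 eqxx finset.trivIset1 inE.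
    by rewrite eq_sym -card_gt0 cardsT card_ord sz.
  apply/forall_inP => U /set1P->; apply/forall_inP => V /set1P->.
  by do 4!apply/forall_inP => ? _; apply/implyP.
rewrite (bigD1 [set [set: 'I__]]) //= big_set1 restr_setT.
rewrite -(@free_cumulant_recE (size s)) // [in X in _ = X + _]sz /=.
apply/eqP; rewrite -subr_eq; apply/eqP; congr (_ - _).
apply: eq_bigr => P /andP[ncP nP]; apply: eq_bigr => V VP.
have /andP[V0 Vs] := proper_block ncP nP VP.
rewrite free_cumulant_recE //; first by rewrite -size_eq0 size_restr -lt0n.
by rewrite size_restr -ltnS -sz.
Qed.

(* Freeness of a family of subalgebras [B i]. *)
Definition free_family (I : choiceType) (B : I -> set A) : Prop :=
  forall s : seq (I * A), s != [::] ->
    sorted (fun p q => p.1 != q.1) s ->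
    (forall p, p \in s -> B p.1 p.2 /\ phi p.2 = 0) ->
    phi (\prod_(p <- s) p.2) = 0.

Definition moment_series (a : A) : nat -> K :=
  \fps_(n | (1 <= n)%N) phi (a ^+ n).

Definition R_transform (a : A) : nat -> K :=
  \fps_(n | (1 <= n)%N) free_cumulant (nseq n a).

End FreeProbability.

Section SemicircularSystem.
Variables (R : realType) (G : groupType).
Implicit Types a : bop R G.

Notation k := (free_cumulant (@group_trace R G)).

Definition semicircular a : Prop :=
  [/\ is_adjoint a a, k [:: a; a] = 1 &
      forall n, (1 <= n)%N -> n != 2%N -> k (nseq n a) = 0].

Definition semicircular_system (I : choiceType) (x : I -> bop R G) : Prop :=
  (forall i, semicircular (x i)) /\
  free_family (@group_trace R G) (fun i => star_alg [set x i]%classic).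

End SemicircularSystem.

Definition catalan (K : fieldType) (k : nat) : K := 'C(k.*2, k)%:R / k.+1%:R.

(* Main.v *)
Require Import Defs.
From HB Require Import structures.
From mathcomp Require Import all_boot all_order all_algebra.
From mathcomp Require Import complex.
From mathcomp Require Import all_classical all_reals.
From mathcomp Require Import ring.

Set Implicit Arguments.
Unset Strict Implicit.
Unset Printing Implicit Defensive.

Import GRing.Theory.
Local Open Scope ring_scope.
Local Open Scope complex_scope.

(** Write [phi] for the trace and let [U_k], for a parameter [c], be the rescaled
    Chebyshev polynomials [U_0 = 1], [U_1 = X], [X U_k = U_(k+1) + c U_(k-1)].
    Three descriptions of the distribution of an element [a] are equivalent; each
    says that it is the semicircular one of variance [c]:
    - the free cumulants of [a] are [c] in order 2 and 0 in all other orders;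
    - [phi (a ^+ n)] is [c ^ (n/2)] times the n/2-th Catalan number for even [n],
      and 0 for odd [n];
    - [phi (U_k a) = 0] for every [k >= 1].
    All three are compared with one array [dyck c m k], the weighted count of
    lattice paths of [m] steps up or down that go from height [k] to height 0
    and never become negative. Noncrossing pairings satisfy its recursion
    ([sum_nc_pairing]), so the moment-cumulant formula gives the link between
    the first two ([moment_of_cumulant], [cumulant_of_moment]); so do the numbers
    [phi (a ^+ m * U_k a)], by the three-term recurrence, which gives the link
    with the third ([moment_of_chebyshev], [chebyshev_of_moment]). The closed
    form of the array is [dyck_catalan].

    Freeness enters only through the third description. To a word [w] in the
    indices attach the product [wick w] of the [U_k (x_i)] (with [c = 1]) over
    its maximal constant blocks [i^k]. These products behave like the basis of
    the full Fock space: [x_i * wick w] is [wick (i w)], plus [wick w'] when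
    [w = i w']. Each is an alternating product of centered elements, so freeness
    makes [phi (wick w)] vanish for [w] nonempty ([phi_wick]). The sum of
    [wick w] over all words of length [k] satisfies the recurrence that defines
    [U_k] at [x_1 + ... + x_N] for the parameter [c = N] ([chebyshev_sum]); hence
    the distribution of the sum is semicircular of variance [N], which is the claim. *)

(** * Lattice paths and Catalan numbers *)

Section WeightedPaths.
Variables (K : fieldType) (c : K).

(** [m] is the number of steps left and [k] the current height. A step down has
    weight [c], a step up has weight 1, and the path has to end at height 0. *)
Fixpoint dyck (m k : nat) : K :=
  if m is m'.+1 then
    dyck m' k.+1 + (if k is k'.+1 then c * dyck m' k' else 0)
  else (k == 0%N)%:R.

Lemma dyckS m k :
  dyck m.+1 k = dyck m k.+1 + (if k is k'.+1 then c * dyck m k' else 0).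
Proof. by []. Qed.

(** A path changes the parity of its height at each step, and descends by at
    most one per step. *)
Lemma dyck_eq0 m k : odd (m + k) || (m < k)%N -> dyck m k = 0.
Proof.
elim: m k => [|m IHm] [|k] //= mk.
  by rewrite IHm ?addr0 //; move: mk; rewrite orbF addn0 addn1 /= => ->.
have /IHm -> : odd (m + k.+2) || (m < k.+2)%N.
  move: mk; rewrite ltnS !addnS /= => /orP[->//|/ltnW/leqW mk].
  by rewrite ltnS mk orbT.
rewrite IHm ?mulr0 ?addr0 //.
by move: mk; rewrite ltnS !addnS /= negbK.
Qed.

(** Reflection principle, with [u] the number of steps up: the paths from [k] to
    0 that do visit -1 are counted by the next lower binomial coefficient, which
    is 0 for [u = 0]. The induction uses Pascal's rule; at height 0, where no
    step down is possible, it uses the symmetry of the central coefficients. *)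
Lemma dyck_ballot u k :
  dyck (k + u.*2) k =
    ('C(k + u.*2, u)%:R - (if u is u'.+1 then 'C(k + u.*2, u')%:R else 0))
      * c ^+ (k + u).
Proof.
have [n le_n] := ubnP (k + u.*2); elim: n u k le_n => // n IHn [|u] [|k].
- by rewrite /= subr0 mulr1.
- rewrite !addn0 ltnS => kn; rewrite dyckS (@dyck_eq0 k k.+2) ?add0r; last first.
    by rewrite ltnS leqnSn orbT.
  by have := IHn 0%N k; rewrite !addn0 => -> //; rewrite !bin0 exprS; ring.
- rewrite !add0n doubleS ltnS => un; rewrite dyckS.
  have := IHn u 1%N; rewrite add1n => -> //; rewrite addr0 add1n; congr (_ * _).
  have -> : 'C(u.*2.+2, u.+1) = (2 * 'C(u.*2.+1, u))%N.
    rewrite binS -(@bin_sub u.*2.+1 u.+1) ?mul2n ?addnn // ?ltnS -?addnn ?leq_addr//.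
    by rewrite subSS addnK addnn.
  case: u un => [|u] un; first by rewrite !bin0 subr0; ring.
  rewrite [in X in _ = _ - X]binS natrD natrM; ring.
- rewrite addSn doubleS !addnS ltnS => kn; rewrite dyckS.
  have -> : (k + u.*2).+2 = (k.+2 + u.*2)%N by rewrite !addSn.
  rewrite IHn ?addSn //.
  have := IHn u.+1 k; rewrite doubleS !addnS => -> //.
  rewrite [in RHS]binS natrD.
  case: u kn => [|u] kn; first by rewrite !bin0 bin1 !addn0 !exprS; ring.
  by rewrite [in X in _ = (_ - X) * _]binS !natrD ?addnS ?doubleS ?addnS !exprS; ring.
Qed.

End WeightedPaths.

Lemma dyck_catalan (K : numFieldType) (c : K) n :
  dyck c n 0 = if odd n then 0 else catalan K n./2 * c ^+ n./2.
Proof.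
case: ifPn => [n_odd|n_even]; first by rewrite dyck_eq0 // addn0 n_odd.
set u := n./2; have -> : n = (0 + u.*2)%N by rewrite add0n halfK (negbTE n_even) subn0.
rewrite dyck_ballot add0n; congr (_ * _); rewrite /catalan; case: {n n_even}u => [|u].
  by rewrite subr0 divr1.
have u0 : (u.+2%:R : K) != 0 by rewrite Num.Theory.pnatr_eq0.
apply: (mulIf u0); rewrite mulrVK ?unitfE //.
have : (u.+1 * 'C(u.+1.*2, u.+1) = u.+2 * 'C(u.+1.*2, u))%N.
  by rewrite mul_bin_left -addnn -(addSnnS u.+1 u) addnK.
move/(congr1 (fun i => i%:R : K)); rewrite !natrM mulrBl => e.
rewrite [X in _ - X]mulrC -e -[u.+2]addn1 natrD; ring.
Qed.

(** * Counting noncrossing pairings *)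

Section NoncrossingPairings.
Variable n : nat.
Implicit Types (A S V : {set 'I_n}) (P Q : {set {set 'I_n}}).

(** The noncrossing pairings of [A] in which the elements of [S] are openers. In
    the induction [S] is an initial segment of [A]: the elements that have been
    read and still wait for a partner. *)
Definition nc_pairing A S P :=
  [&& finset.partition P A, noncrossing P, [forall V in P, #|V| == 2%N]
    & [forall V in P, ~~ (V \subset S)]].

Lemma nc_pairingP A S P :
  reflect [/\ finset.partition P A, noncrossing P,
              forall V, V \in P -> #|V| = 2%N
            & forall V, V \in P -> ~~ (V \subset S)]
          (nc_pairing A S P).
Proof.
apply: (iffP and4P) => -[pA nc P2 PS]; split=> //.
- by move=> V /(forall_inP P2)/eqP.
- exact/forall_inP.
- by apply/forall_inP => V /P2 ->.
- exact/forall_inP.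
Qed.

Lemma noncrossingP P :
  reflect (forall U V i j k l, U \in P -> V \in P ->
             i \in U -> j \in V -> k \in U -> l \in V ->
             (i < j < k)%N -> (k < l)%N -> U = V)
          (noncrossing P).
Proof.
apply: (iffP idP) => [nc U V i j k l UP VP iU jV kU lV /andP[ij jk] kl|nc].
  move/forall_inP: nc => /(_ U UP)/forall_inP/(_ V VP)/forall_inP/(_ i iU).
  move/forall_inP=> /(_ j jV)/forall_inP/(_ k kU)/forall_inP/(_ l lV).
  by rewrite ij jk kl => /eqP.
apply/forall_inP => U UP; apply/forall_inP => V VP; apply/forall_inP => i iU.
apply/forall_inP => j jV; apply/forall_inP => k kU; apply/forall_inP => l lV.
by apply/implyP => /and3P[ij jk kl]; apply/eqP/(nc U V i j k l); rewrite ?ij.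
Qed.

Lemma nc_pairing_remove A S P V :
  nc_pairing A S P -> V \in P -> nc_pairing (A :\: V) (S :\: V) (P :\ V).
Proof.
move=> /nc_pairingP[pA /noncrossingP nc P2 PS] VP; apply/nc_pairingP; split.
- exact: partitionD1.
- apply/noncrossingP => U W i j k l /setD1P[_ UP] /setD1P[_ WP]; exact: nc.
- by move=> U /setD1P[_ /P2].
- move=> U /setD1P[_ /PS]; apply: contraNN => /fintype.subset_trans; apply.
  exact: finset.subsetDl.
Qed.

(** In the section below [a] is the first unread element and [b] the last waiting
    one. Either [a] starts to wait as well ([nc_pairing_open]), or it is paired
    with a waiting element. By noncrossingness that element is [b]
    ([nc_pairing_closeE]), and the block of [a] and [b] can be deleted or put back
    freely ([nc_pairing_remove], [nc_pairing_insert]). *)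
Section Step.
Variables (A S : {set 'I_n}) (a : 'I_n).
Hypothesis SA : S \subset A.
Hypothesis aA : a \in A :\: S.
Hypothesis a_min : forall i, i \in A :\: S -> (a <= i)%N.
Hypothesis Sa : forall i, i \in S -> (i < a)%N.

Lemma nc_pairing_open P :
  nc_pairing A (a |: S) P =
  nc_pairing A S P && ~~ [exists s in S, [set s; a]%SET \in P].
Proof.
apply/idP/andP => [/nc_pairingP[pA nc P2 PaS]|].
  split.
    apply/nc_pairingP; split=> // V /PaS; apply: contraNN => /fintype.subset_trans; apply.
    exact: finset.subsetUr.
  apply/negP => /exists_inP[s sS /PaS]/negP; apply.
  by rewrite finset.subUset !finset.sub1set !inE sS eqxx orbT.
case=> /nc_pairingP[pA nc P2 PS] /exists_inPn no; apply/nc_pairingP; split=> // V VP.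
apply/negP => VaS; have aV : a \in V.
  apply: contraT => aV; case/negP: (PS V VP); apply/fintype.subsetP => i iV.
  have := fintype.subsetP VaS i iV; rewrite !inE => /predU1P[ia|//].
  by rewrite -ia iV in aV.
have : #|V :\ a| == 1%N.
  by move: (P2 V VP); rewrite (cardsD1 a) aV add1n => -[->].
case/cards1P=> s Vs.
have sS : s \in S.
  have: s \in V :\ a by rewrite Vs inE.
  rewrite !inE => /andP[sa sV].
  by have := fintype.subsetP VaS s sV; rewrite !inE (negbTE sa).
by have /negP := no s sS; apply; rewrite finset.setUC -Vs finset.setD1K.
Qed.

Variable b : 'I_n.
Hypothesis bS : b \in S.
Hypothesis b_max : forall i, i \in S -> (i <= b)%N.

(** If [a] were paired with some [s < b], then the partner of [b], which is not
    in [S], would lie after [a] and its block would cross that of [s] and [a]. *)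
Lemma nc_pairing_closeE P :
  nc_pairing A S P ->
  [exists s in S, [set s; a]%SET \in P] = ([set b; a]%SET \in P).
Proof.
move=> /nc_pairingP[pA nc P2 PS]; apply/exists_inP/idP => [[s sS sP]|bP]; last first.
  by exists b.
have bA : b \in finset.cover P.
  by rewrite (cover_partition pA) (fintype.subsetP SA).
have tP := partition_trivIset pA.
have [V VP bV] := finset.bigcupP bA.
have [d dV dS] : exists2 d, d \in V & d \notin S.
  exact/fintype.subsetPn/PS.
have dAS : d \in A :\: S.
  by rewrite inE dS (fintype.subsetP (partitionS pA VP)).
have [sb|sb] := eqVneq s b; first by rewrite -sb.
have Vsa : V = [set s; a]%SET; last first.
  move: bV; rewrite Vsa !inE eq_sym (negbTE sb) => /eqP ba.
  by have := Sa bS; rewrite ba ltnn.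
have [da|da] := eqVneq d a.
  have aV : a \in V by rewrite -da.
  rewrite -(def_pblock tP VP aV); apply: def_pblock => //.
  by rewrite !inE eqxx orbT.
apply/esym/(noncrossingP _ nc _ _ s b a d sP VP) => //.
- by rewrite !inE eqxx.
- by rewrite !inE eqxx orbT.
- by rewrite Sa // andbT ltn_neqAle b_max // andbT.
- by rewrite ltn_neqAle a_min // andbT eq_sym.
Qed.

(** No element of [A] lies strictly between [b] and [a], so their block crosses
    no other. *)
Lemma nc_pairing_insert P :
  nc_pairing (A :\: [set b; a]%SET) (S :\: [set b; a]%SET) P ->
  [set b; a]%SET \notin P /\ nc_pairing A S ([set b; a]%SET |: P).
Proof.
set B := [set b; a]%SET => /nc_pairingP[pA nc P2 PS].
have aA' : a \in A by move: aA; rewrite inE => /andP[].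
have aS : a \notin S by move: aA; rewrite inE => /andP[].
have bA : b \in A := fintype.subsetP SA b bS.
have ba : b != a by apply: contraNneq aS => <-.
have BA : B \subset A by rewrite finset.subUset !finset.sub1set bA.
have BnP : B \notin P.
  apply/negP => /(partitionS pA) /fintype.subsetP/(_ b).
  by rewrite !inE eqxx /= => /(_ isT).
have gap V : V \in P -> forall i, i \in V -> ~~ (b < i < a)%N.
  move=> VP i iV; apply/negP => /andP[bi ia].
  have := fintype.subsetP (partitionS pA VP) i iV; rewrite !inE => /andP[_ iA].
  have [iS|iS] := boolP (i \in S); first by have := b_max iS; rewrite leqNgt bi.
  by have := @a_min i; rewrite inE iS iA leqNgt ia => /(_ isT).
split=> //; apply/nc_pairingP; split.
- rewrite -{1}(finset.setID A B) (finset.setIidPr BA).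
  apply: partitionU1 => //; first by apply/set0Pn; exists b; rewrite !inE eqxx.
  rewrite -finset.setI_eq0; apply/eqP/finset.setP => i.
  by rewrite !inE; case: (i == b); case: (i == a).
- apply/noncrossingP => U V i j k l /setU1P[->|UP] /setU1P[->|VP] //; last first.
  + exact: (noncrossingP _ nc).
  + move=> iU jB kU lB /andP[ij jk] kl.
    have jl := ltn_trans jk kl.
    case/set2P: jB ij jk jl => -> ij jk; case/set2P: lB kl => -> kl; rewrite ?ltnn //.
      by have := gap U UP k kU; rewrite jk kl.
    by rewrite ltnNge ltnW // Sa.
  + move=> iB jV kB lV /andP[ij jk] _; have ik := ltn_trans ij jk.
    case/set2P: iB ij ik => -> ij; case/set2P: kB jk => -> jk; rewrite ?ltnn //.
      by have := gap V VP j jV; rewrite ij jk.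
    by rewrite ltnNge ltnW // Sa.
- by move=> V /setU1P[->|/P2//]; rewrite cards2 ba.
- move=> V /setU1P[->|VP].
    by rewrite finset.subUset !finset.sub1set (negbTE aS) andbF.
  have := PS V VP; apply: contraNN => VS; rewrite finset.subsetD VS.
  have := partitionS pA VP; rewrite finset.subsetD => /andP[_ ->] //.
Qed.

End Step.

Variables (K : fieldType) (c : K).

(** Reading the elements of [A :\: S] in increasing order, with the number of
    waiting elements as height, turns a pairing into a path: opening a block is
    a step up, and closing one is a step down, which carries its weight [c]. *)
Theorem sum_nc_pairing m A S :
  #|A :\: S| = m -> S \subset A ->
  (forall i j, i \in S -> j \in A :\: S -> (i < j)%N) ->
  \sum_(P | nc_pairing A S P) c ^+ #|P| = dyck c m #|S|.
Proof.
elim: m A S => [|m IHm] A S cAS SA lt_SA.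
  have AS : A = S.
    by apply/eqP; rewrite finset.eqEsubset SA -finset.setD_eq0 -cards_eq0 cAS.
  have P0 P : nc_pairing A S P = (S == finset.set0) && (P == finset.set0).
    apply/nc_pairingP/andP => [[pA nc P2 PS]|[/eqP S0 /eqP ->]].
      have /eqP PE : P == finset.set0.
        apply: contraT => /set0Pn[V VP]; have := PS V VP.
        by rewrite -AS (partitionS pA VP).
      by move: pA; rewrite PE -AS eqxx -(inj_eq val_inj) => /cover_partition <-;
        rewrite /finset.cover big_set0 eqxx.
    split=> [||V|V]; rewrite ?inE //; first by rewrite AS S0 partition_set0.
    by apply/noncrossingP => U V i j k l; rewrite inE.
  rewrite (eq_bigl _ _ P0) /= cards_eq0.
  case: eqP => _ /=; last by rewrite big_pred0_eq.
  by rewrite big_pred1_eq cards0 expr0.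
have [i0 i0AS] : exists i, i \in A :\: S by apply/card_gt0P; rewrite cAS.
pose a := [arg min_(i < i0 in A :\: S) (i : nat)]%N.
have [aAS a_min] : a \in A :\: S /\ forall i, i \in A :\: S -> (a <= i)%N.
  by rewrite /a; case: arg_minnP => // i iAS le_i; split.
have Sa i : i \in S -> (i < a)%N by move=> iS; apply: lt_SA.
have [aS aA] : a \notin S /\ a \in A by move: aAS; rewrite inE => /andP[].
have open_sum :
    \sum_(P | nc_pairing A (a |: S) P) c ^+ #|P| = dyck c m #|S|.+1.
  rewrite -[#|S|.+1]add1n -[1%N]/(true : nat) -aS -cardsU1; apply: IHm.
  - apply/eqP; rewrite -eqSS -cAS (cardsD1 a (A :\: S)) aAS add1n.
    by rewrite finset.setDDl finset.setUC.
  - by rewrite finset.subUset finset.sub1set aA.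
  - move=> i j /setU1P[->|iS]; rewrite !inE negb_or -andbA => /and3P[ja jS jA].
      by rewrite ltn_neqAle eq_sym ja a_min // inE jS.
    by apply: lt_SA; rewrite ?inE ?jS.
rewrite (bigID (fun P => [exists s in S, [set s; a]%SET \in P])) /= addrC.
(* [a] opens a block: a step up *)
rewrite -(eq_bigl _ _ (nc_pairing_open A S a)) open_sum; congr (_ + _).
(* [a] closes the block of the last waiting element: a step down *)
have [S0|[b0 b0S]] := set_0Vmem S.
  rewrite S0 cards0 big_pred0 // => P; apply/negP => /andP[_ /exists_inP[s]].
  by rewrite inE.
pose b := [arg max_(i > b0 in S) (i : nat)]%N.
have [bS b_max] : b \in S /\ forall i, i \in S -> (i <= b)%N.
  by rewrite /b; case: arg_maxnP => // i iS le_i; split.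
set B := [set b; a]%SET.
have bA : b \in A := fintype.subsetP SA b bS.
have ba : b != a by apply: contraNneq aS => <-.
have SB : S :\: B = S :\ b.
  apply/finset.setP => i; rewrite !inE negb_or -andbA; congr (_ && _).
  by rewrite andbC; case: eqP => [->|]; rewrite ?andbT // (negbTE aS).
have [k cS] : exists k, #|S| = k.+1.
  by exists #|S :\ b|; rewrite (cardsD1 b) bS.
have cSB : #|S :\: B| = k by move: cS; rewrite SB (cardsD1 b) bS => -[].
rewrite cS -cSB -(IHm (A :\: B)); first last.
- move=> i j; rewrite !inE => /andP[_ iS] /andP[jSB /andP[jB jA]].
  apply: lt_SA => //; rewrite inE jA andbT.
  by move: jSB; rewrite jB.
- exact: finset.setSD.
- apply/eqP; rewrite -eqSS -cAS (cardsD1 a (A :\: S)) aAS add1n eqSS; apply/eqP.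
  apply: eq_card => i; rewrite !inE.
  case: (eqVneq i a) => [->|ia] /=; first by rewrite orbT.
  rewrite orbF; case: (eqVneq i b) => [->|ib] /=; first by rewrite bS.
  by [].
rewrite (reindex_onto (fun P => B |: P) (fun P => P :\ B)); last first.
  move=> P /andP[ncP]; rewrite (nc_pairing_closeE SA a_min Sa bS b_max ncP) => BP.
  exact: finset.setD1K.
rewrite big_distrr /=; apply: eq_big => [P|P].
  apply/andP/idP => [[/andP[ncP _] /eqP PE]|ncP].
    by rewrite -PE; apply: nc_pairing_remove ncP _; rewrite !inE eqxx.
  have [BP ncBP] := nc_pairing_insert SA aAS a_min Sa bS b_max ncP.
  split; last by rewrite finset.setU1K.
  rewrite ncBP (nc_pairing_closeE SA a_min Sa bS b_max ncBP).
  by rewrite !inE eqxx.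
case/andP=> _ /eqP PE; have BP : B \notin P by rewrite -PE !inE eqxx.
by rewrite cardsU1 BP exprS.
Qed.

End NoncrossingPairings.

(** * Chebyshev polynomials, moments and cumulants *)

Section Chebyshev.
Variables (K : fieldType) (A : algType K) (phi : A -> K).
Hypothesis phi_linear : forall c a b, phi (c *: a + b) = c * phi a + phi b.
Variables (c : K) (a : A).

Fixpoint chebyshev n : A :=
  match n with
  | 0 => 1
  | 1 => a
  | (n'.+1 as m).+1 => a * chebyshev m - c *: chebyshev n'
  end.

Lemma chebyshevS n :
  a * chebyshev n = chebyshev n.+1 + (if n is k.+1 then c *: chebyshev k else 0).
Proof. by case: n => [|n]; rewrite ?mulr1 ?addr0 // subrK. Qed.

Lemma phiD b d : phi (b + d) = phi b + phi d.
Proof. by rewrite -[b]scale1r phi_linear mul1r scale1r. Qed.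

Lemma phi0 : phi 0 = 0.
Proof. by apply: (addrI (phi 0)); rewrite -phiD !addr0. Qed.

Lemma phiZ e b : phi (e *: b) = e * phi b.
Proof. by rewrite -[e *: b]addr0 phi_linear phi0 addr0. Qed.

(** With [m] steps left and height [n], this is the recursion of [dyck]. *)
Lemma phi_chebyshevS m n :
  phi (a ^+ m.+1 * chebyshev n) =
  phi (a ^+ m * chebyshev n.+1) +
  (if n is k.+1 then c * phi (a ^+ m * chebyshev k) else 0).
Proof.
rewrite exprSr -mulrA chebyshevS mulrDr phiD; congr (_ + _).
by case: n => [|n]; rewrite ?mulr0 ?phi0 // -scalerAr phiZ.
Qed.

Lemma moment_of_chebyshev :
  (forall n, phi (chebyshev n) = (n == 0%N)%:R) ->
  forall n, phi (a ^+ n) = dyck c n 0.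
Proof.
move=> phiU n; rewrite -[a ^+ n]mulr1 -[1]/(chebyshev 0).
elim: n 0%N => [|m IHm] k; first by rewrite mul1r phiU.
by rewrite phi_chebyshevS dyckS IHm; case: k => // k; rewrite IHm.
Qed.

(** The recursion expresses the column of height [n + 1] by those of heights [n]
    and [n - 1], so the column of height 0, given by the moments, determines all
    of them; the row of 0 remaining steps is the claim. *)
Lemma chebyshev_of_moment :
  (forall n, phi (a ^+ n) = dyck c n 0) ->
  forall n, phi (chebyshev n) = (n == 0%N)%:R.
Proof.
move=> phia n; rewrite -[chebyshev n]mul1r -(expr0 a) -[RHS]/(dyck c 0 n).
have [m le_nm] := ubnP n; elim: m n le_nm 0%N => // m IHm [|n] le_nm p.
  by rewrite mulr1 phia.
have := phi_chebyshevS p n; rewrite (IHm n) // dyckS.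
case: n le_nm => [|n] le_nm; first by rewrite !addr0.
by rewrite (IHm n (ltnW le_nm)) => /addIr.
Qed.

End Chebyshev.

Section CumulantsOfPowers.
Variables (K : fieldType) (A : algType K) (phi : A -> K) (a : A) (c : K).

Lemma restr_const (s : seq A) (V : {set 'I_(size s)}) :
  s = nseq (size s) a -> restr V = nseq #|V| a.
Proof.
move=> sa; rewrite -(size_restr V); apply/all_pred1P/allP => b /mapP[i _ ->] /=.
have : tnth (in_tuple s) i \in s by exact: mem_tnth.
by rewrite [X in _ \in X -> _]sa => /nseqP[-> _].
Qed.

(** The product of weights vanishes unless all blocks are pairs. *)
Lemma sum_NC_pairings n : (0 < n)%N ->
  \sum_(P : {set {set 'I_n}} | NC P) \prod_(V in P) (if #|V| == 2%N then c else 0)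
  = dyck c n 0.
Proof.
move=> n0.
have <- : \sum_(P | nc_pairing [set: 'I_n] finset.set0 P) c ^+ #|P| = dyck c n 0.
  rewrite (@sum_nc_pairing n K c n) ?cards0 ?finset.sub0set //.
    by rewrite finset.setD0 cardsT card_ord.
  by move=> i j; rewrite inE.
rewrite (bigID (fun P : {set {set 'I_n}} => [forall V in P, #|V| == 2%N])) /=.
rewrite [X in _ + X]big1 ?addr0 => [|P /andP[_ /forall_inPn[V VP V2]]]; last first.
  by rewrite (bigD1 V) //= (negbTE V2) mul0r.
apply: eq_big => [P|P /andP[_ /forall_inP P2]]; last first.
  by rewrite -prodr_const; apply: eq_bigr => V /P2 ->.
apply/andP/nc_pairingP => [[/andP[pP nc] P2]|[pP nc P2 _]].
  split=> // V VP; first exact/eqP/(forall_inP P2).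
  rewrite finset.subset0; exact: partition_neq0 pP VP.
by split; [exact/andP | apply/forall_inP => V /P2 ->].
Qed.

Lemma moment_of_cumulant :
  (forall n, (0 < n)%N ->
     free_cumulant phi (nseq n a) = if n == 2%N then c else 0) ->
  phi 1 = 1 -> forall n, phi (a ^+ n) = dyck c n 0.
Proof.
move=> ka phi1 [|n]; first by rewrite expr0 phi1.
set s := nseq n.+1 a; have sz : size s = n.+1 by rewrite size_nseq.
have sa : s = nseq (size s) a by rewrite sz.
have -> : a ^+ n.+1 = \prod_(b <- s) b by rewrite big_nseq iter_mulr_1.
rewrite moment_cumulant // -sz -sum_NC_pairings ?sz //.
apply: eq_bigr => P /andP[pP _]; apply: eq_bigr => V VP.
rewrite restr_const // ka // card_gt0; exact: partition_neq0 pP VP.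
Qed.

(** By induction, the moment-cumulant formula and [sum_NC_pairings] agree in the
    terms of all partitions except the one with a single block, since the other
    partitions only involve cumulants of lower order. *)
Lemma cumulant_of_moment :
  (forall n, phi (a ^+ n) = dyck c n 0) ->
  forall n, (0 < n)%N ->
    free_cumulant phi (nseq n a) = if n == 2%N then c else 0.
Proof.
move=> phia n; elim/ltn_ind: n => -[//|n] IHn _.
set s := nseq n.+1 a; have sz : size s = n.+1 by rewrite size_nseq.
have sa : s = nseq (size s) a by rewrite sz.
have <- : (size s == 2%N) = (n.+1 == 2%N) by rewrite sz.
have := phia n.+1.
have -> : a ^+ n.+1 = \prod_(b <- s) b by rewrite big_nseq iter_mulr_1.
rewrite moment_cumulant // -{1}sz -sum_NC_pairings ?sz //.
have [ncT|] := boolP (NC [set [set: 'I_(size s)]]); last first.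
  case/negP; apply/andP; split.
    rewrite /finset.partition /finset.cover big_set1 eqxx finset.trivIset1 inE.
    by rewrite eq_sym -card_gt0 cardsT card_ord.
  by apply/noncrossingP => U V i j k l /set1P-> /set1P->.
rewrite (bigD1 [set [set: 'I__]]) // [RHS](bigD1 [set [set: 'I__]]) //.
rewrite !big_set1 restr_setT cardsT card_ord.
rewrite [X in _ + X = _](eq_bigr
  (fun P : {set {set 'I_(size s)}} => \prod_(V in P) (if #|V| == 2%N then c else 0))); first by move/addIr.
move=> P /andP[ncP nP]; apply: eq_bigr => V VP.
have /andP[V0 Vs] := proper_block ncP nP VP.
by rewrite restr_const // IHn // -sz.
Qed.

End CumulantsOfPowers.

(** * Sums of free semicircular elements *)

Section FreeFamily.
Variables (K : fieldType) (A : algType K) (phi : A -> K).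
Hypothesis phi_linear : forall c a b, phi (c *: a + b) = c * phi a + phi b.
Hypothesis phi1 : phi 1 = 1.
Variables (I : finType) (x : I -> A).

(** Defined by the Fock space relation rather than as a product over blocks: left
    multiplication by [x i] creates the letter [i] and annihilates a leading
    letter [i]. The product formula follows from [wick_block]. *)
Fixpoint wick (w : seq I) : A :=
  if w is i :: w' then
    x i * wick w' -
      (if w' is j :: w'' then if i == j then wick w'' else 0 else 0)
  else 1.

(** On a block of one letter the recursion of [wick] is that of [chebyshev]. *)
Lemma wick_block i k w : ohead w != Some i ->
  wick (nseq k i ++ w) = chebyshev 1 (x i) k * wick w.
Proof.
move=> iw; have [n] := ubnP k; elim: n k => // n IHn [|[|k]] le_kn.
- by rewrite mul1r.
- case: w iw {IHn} => [|j w] iw /=; first by rewrite subr0.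
  have /negbTE -> : i != j by apply: contraNneq iw => ->.
  by rewrite subr0.
- rewrite -[LHS]/(x i * wick (nseq k.+1 i ++ w)
    - (if i == i then wick (nseq k i ++ w) else 0)) eqxx.
  rewrite (IHn k.+1) // (IHn k (ltnW le_kn)).
  by rewrite [chebyshev _ _ k.+2]/= scale1r mulrBl mulrA.
Qed.

(** Cutting [w] into maximal constant blocks; the condition on the first index
    is what the induction needs to keep neighbouring indices distinct. *)
Lemma wick_alternating (B : I -> set A) :
  (forall i n, B i (chebyshev 1 (x i) n)) ->
  (forall i n, phi (chebyshev 1 (x i) n) = (n == 0%N)%:R) ->
  forall w, exists s : seq (I * A),
    [/\ ohead (map fst s) = ohead w, sorted (fun p q => p.1 != q.1) s,
        forall p, p \in s -> B p.1 p.2 /\ phi p.2 = 0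
      & wick w = \prod_(p <- s) p.2].
Proof.
move=> BU phiU w; have [n] := ubnP (size w); elim: n w => // n IHn [|i w] le_wn.
  by exists [::]; rewrite big_nil.
(* the length of the first block of [i :: w] *)
pose k := find (predC1 i) (i :: w).
have wE : i :: w = nseq k i ++ drop k (i :: w).
  rewrite -[LHS](cat_take_drop k); congr (_ ++ _).
  have sk : size (take k (i :: w)) = k by rewrite size_takel ?find_size.
  rewrite -[in RHS]sk; apply/all_pred1P/(all_nthP i) => j; rewrite sk => jk.
  by rewrite nth_take //; have /= /negbT := before_find i jk; rewrite negbK.
have k0 : (0 < k)%N by rewrite /k /= eqxx.
have iw : ohead (drop k (i :: w)) != Some i.
  case: (ltnP k (size (i :: w))) => [lt_k|/drop_oversize -> //].
  rewrite (drop_nth i lt_k) /= (inj_eq Some_inj); have := nth_find i (a := predC1 i) (s := i :: w).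
  by rewrite has_find => /(_ lt_k).
have [|s [hs alt_s Bs ws]] := IHn (drop k (i :: w)).
  rewrite size_drop /= -ltnS (leq_trans _ le_wn) // ltnS.
  by rewrite -subn_gt0 subKn //; apply: find_size.
exists ((i, chebyshev 1 (x i) k) :: s); split => //.
- rewrite /=; case: s hs alt_s {Bs ws} => //= p s hs ->; rewrite andbT.
  by move: hs iw => <- /=; rewrite (inj_eq Some_inj) eq_sym.
- move=> p; rewrite inE => /predU1P[->/=|/Bs//]; split; first exact: BU.
  by rewrite phiU eqn0Ngt k0.
- by rewrite big_cons -ws -(@wick_block i k _ iw) -wE.
Qed.

Lemma phi_wick (B : I -> set A) :
  free_family phi B ->
  (forall i n, B i (chebyshev 1 (x i) n)) ->
  (forall i n, phi (chebyshev 1 (x i) n) = (n == 0%N)%:R) ->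
  forall w, phi (wick w) = (w == [::])%:R.
Proof.
move=> freeB BU phiU [|i w]; first by rewrite eqxx.
have [s [hs alt_s Bs ->]] := wick_alternating BU phiU (i :: w).
by apply: freeB => //; case: s hs {alt_s Bs}.
Qed.

Fixpoint words n : seq (seq I) :=
  if n is n'.+1 then [seq i :: w | i <- enum I, w <- words n'] else [:: [::]].

Lemma big_words (F : seq I -> A) n :
  \sum_(w <- words n.+1) F w = \sum_(i : I) \sum_(w <- words n) F (i :: w).
Proof. by rewrite /= big_allpairs_dep big_enum. Qed.

(** Multiplying the sum over the words of length [n + 1] by the sum of the [x i]
    creates every word of length [n + 2] once, and annihilates to every word of
    length [n] once for each index; hence the parameter [#|I|]. *)
Lemma chebyshev_sum n :
  chebyshev #|I|%:R (\sum_i x i) n = \sum_(w <- words n) wick w.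
Proof.
have [m] := ubnP n; elim: m n => // m IHm [|[|n]] le_nm.
- by rewrite big_seq1.
- by rewrite big_words; apply: eq_bigr => i _; rewrite big_seq1 /= mulr1 subr0.
rewrite big_words [LHS]/= -/(chebyshev _ _ n.+1) (IHm n.+1) // (IHm n (ltnW le_nm)).
under [RHS]eq_bigr => i _ do rewrite sumrB -big_distrr.
rewrite sumrB -big_distrl; congr (_ - _) => /=.
rewrite [RHS](eq_bigr (fun=> \sum_(w <- words n) wick w)) => [|i _].
  by rewrite sumr_const scaler_nat.
rewrite -/(words n.+1) big_words (bigD1 i) //= [X in _ + X]big1 ?addr0 => [|j ji].
  by apply: eq_bigr => w _; rewrite eqxx.
by rewrite big1 // => w _; rewrite eq_sym (negbTE ji).
Qed.

Lemma phi_sum (J : Type) (r : seq J) (F : J -> A) :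
  phi (\sum_(j <- r) F j) = \sum_(j <- r) phi (F j).
Proof.
elim: r => [|j r IHr]; first by rewrite !big_nil (phi0 phi_linear).
by rewrite !big_cons (phiD phi_linear) IHr.
Qed.

Lemma phi_chebyshev_sum (B : I -> set A) :
  free_family phi B ->
  (forall i n, B i (chebyshev 1 (x i) n)) ->
  (forall i n, phi (chebyshev 1 (x i) n) = (n == 0%N)%:R) ->
  forall n, phi (chebyshev #|I|%:R (\sum_i x i) n) = (n == 0%N)%:R.
Proof.
move=> freeB BU phiU n; rewrite chebyshev_sum phi_sum.
under eq_bigr => w _ do rewrite (phi_wick freeB BU phiU).
case: n => [|n]; first by rewrite big_seq1.
by rewrite /= big_allpairs_dep big1 // => i _; rewrite big1.
Qed.

End FreeFamily.

(** Freeness of the system concerns the star-algebras of its elements, so the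
    polynomials in [a] have to lie there. *)
Lemma chebyshev_star_alg (R : realType) (G : groupType) (a : bop R G) n :
  star_alg [set a]%classic (chebyshev 1 a n).
Proof.
move=> M [M1 Mlin Mmul] _ Ma; apply: set_mem; rewrite -[_ \in _]/(_ \in mem M).
have aM : a \in mem M by apply: mem_set; exact: Ma.
have MB b d : b \in mem M -> d \in mem M -> b - d \in mem M.
  by move=> bM dM; rewrite addrC -scaleN1r; apply: Mlin.
have [m] := ubnP n; elim: m n => // m IHm [|[|n]] le_nm //=.
rewrite scale1r; apply: MB; last exact: (IHm n (ltnW le_nm)).
apply: Mmul => //; exact: (IHm n.+1 le_nm).
Qed.

Lemma group_trace_linear (R : realType) (G : groupType) (c : R[i])
    (S T : bop R G) :
  group_trace (c *: S + T) = c * group_trace S + group_trace T.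
Proof. by []. Qed.

Lemma group_trace1 (R : realType) (G : groupType) :
  group_trace (1 : bop R G) = 1.
Proof. by rewrite /group_trace /= /delta_fun eqxx. Qed.

Theorem mainTheorem3 (R : realType) (N : nat)
    (x : 'I_N -> bop R (free_group 'I_N)) :
  (forall j, @group_vN R (free_group 'I_N) (x j)) ->
  semicircular_system x ->
  vN (range x) = @group_vN R (free_group 'I_N) ->
  let T0 := \sum_(j < N) x j in
  moment_series (@group_trace R (free_group 'I_N)) T0
    = (\fps_(n | (2 <= n)%N && ~~ odd n)
        (catalan R[i] n./2 * (N ^ n./2)%:R)) /\
  R_transform (@group_trace R (free_group 'I_N)) T0
    = (\fps_(n | n == 2%N) N%:R).
Proof.
move=> _ [semix freex] _ T0; set tau := @group_trace R (free_group 'I_N).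
have tauU i n : tau (chebyshev 1 (x i) n) = (n == 0%N)%:R.
  apply: (chebyshev_of_moment (@group_trace_linear _ _)).
  apply: moment_of_cumulant (group_trace1 _ _) => {}n n0.
  have [_ k2 k0] := semix i.
  by have [->|n2] := eqVneq n 2%N; [exact: k2 | exact: k0].
have momT n : tau (T0 ^+ n) = dyck N%:R n 0.
  apply: (moment_of_chebyshev (@group_trace_linear _ _)) => {}n.
  have := phi_chebyshev_sum (@group_trace_linear _ _) (group_trace1 _ _) freex.
  rewrite card_ord; apply; last exact: tauU.
  by move=> i m; exact: chebyshev_star_alg.
split; apply/funext => n.
- rewrite /moment_series momT dyck_catalan natrX.
  by case: n => [|[|n]] //=; case: odd.
- rewrite /R_transform; case: n => // n.
  by rewrite (cumulant_of_moment momT).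
Qed.
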